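(* Let $R$ be a commutative ring such that every nonzero proper ideal of $R$ is an sdf-absorbing ideal of $R$. Then $R/nil(R)$ is von Neumann regular. In particular, $\dim(R) = 0$. Moreover, if $R$ is not reduced, then $nil(R)$ is the unique minimal nonzero ideal of $R$.
   Context: All rings are commutative with identity $1 \neq 0$. A proper ideal $I$ of a commutative ring $R$ is a square-difference factor absorbing ideal (sdf-absorbing ideal) of $R$ if whenever $a, b \in R$ are both nonzero and $a^2 - b^2 \in I$, then $a + b \in I$ or $a - b \in I$. Here $nil(R)$ is the ideal of nilpotent elements of $R$, $\dim(R)$ is the Krull dimension of $R$, and $R$ is reduced if $nil(R) = \{0\}$. A commutative ring $R$ is von Neumann regular if for every $x \in R$ there is a $y \in R$ with $x^2 y = x$. *)

(* Defs.v *)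
From HB Require Import structures.
From mathcomp Require Import all_boot all_algebra.
From mathcomp Require Import boolp.

Set Implicit Arguments.
Unset Strict Implicit.
Unset Printing Implicit Defensive.

Import GRing.Theory.

Local Open Scope ring_scope.

(* Ideals are boolean predicates, as in ring_quotient; classically every      *)
(* subset is of this form. The library's [idealr_closed] says "proper ideal", *)
(* so the following notion is needed to talk about ideals that may be R.      *)
Definition ideal_closed (R : comNzRingType) (I : {pred R}) : Prop :=
  0 \in I /\ forall a, {in I &, forall u v, a * u + v \in I}.

Lemma idealr_closedE (R : comNzRingType) (I : {pred R}) :
  idealr_closed I <-> ideal_closed I /\ 1 \notin I.
Proof. by split=> [[]|[[]]]. Qed.

Definition nonzero_ideal (R : comNzRingType) (I : {pred R}) : Prop :=
  exists2 x, x \in I & x != 0.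

Definition sdf_absorbing (R : comNzRingType) (I : {pred R}) : Prop :=
  idealr_closed I /\
  forall a b : R, a != 0 -> b != 0 ->
    a ^+ 2 - b ^+ 2 \in I -> a + b \in I \/ a - b \in I.

Definition minimal_nonzero_ideal (R : comNzRingType) (I : {pred R}) : Prop :=
  [/\ ideal_closed I, nonzero_ideal I &
      forall J : {pred R}, ideal_closed J -> nonzero_ideal J ->
        {subset J <= I} -> J =i I].

Definition nilradical (R : comNzRingType) : R -> bool :=
  fun x => `[< exists n : nat, x ^+ n = 0 >].
Arguments nilradical R : clear implicits.

Lemma nilradical_idealr_closed (R : comNzRingType) :
  idealr_closed (nilradical R).
Proof.
split=> [||a u v /asboolP[m um] /asboolP[n vn]].
- by apply/asboolP; exists 1%N; rewrite expr1.
- by apply/asboolP => -[n]; rewrite expr1n => /eqP; rewrite oner_eq0.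
- apply/asboolP; exists (m + n)%N; rewrite exprDn big1 // => i _.
  have [le_ni|lt_in] := leqP n i.
    by rewrite -(subnKC le_ni) exprD vn mul0r mulr0 mul0rn.
  have le_m : (m <= m + n - i)%N by rewrite -addnBA ?leq_addr // ltnW.
  by rewrite exprMn -(subnKC le_m) [u ^+ _]exprD um mul0r mulr0 mul0r mul0rn.
Qed.

HB.instance Definition _ (R : comNzRingType) :=
  isIdealr.Build R (nilradical R) (nilradical_idealr_closed R).

Definition reduced (R : comNzRingType) : Prop := nilradical R =i pred1 0.
Arguments reduced R : clear implicits.

Definition von_neumann_regular (R : comNzRingType) : Prop :=
  forall x : R, exists y : R, x ^+ 2 * y = x.
Arguments von_neumann_regular R : clear implicits.

Definition is_prime_ideal (R : comNzRingType) (P : {pred R}) : Prop :=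
  idealr_closed P /\ prime_idealr_closed P.

(* P 0 < P 1 < ... < P n is a chain of length n; P i is irrelevant for i > n. *)
Definition prime_chain (R : comNzRingType) (n : nat) (P : nat -> {pred R}) :
    Prop :=
  (forall i, (i <= n)%N -> is_prime_ideal (P i)) /\
  (forall i, (i < n)%N ->
    {subset P i <= P i.+1} /\ exists2 x, x \in P i.+1 & x \notin P i).

(* The supremum of the lengths of chains of primes is the finite value n.     *)
Definition krull_dim_is (R : comNzRingType) (n : nat) : Prop :=
  (exists P : nat -> {pred R}, prime_chain n P) /\
  (forall (m : nat) (P : nat -> {pred R}), prime_chain m P -> (m <= n)%N).
Arguments krull_dim_is R n : clear implicits.

(* Main.v *)
Require Import Defs.
From mathcomp Require Import all_boot all_algebra.
From mathcomp Require Import boolp classical_sets.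

(** The conclusion rests on one observation: a nonzero sdf-absorbing ideal [I]
    is radical.  Indeed, if [x] is nonzero and [x ^+ 2] lies in [I], pick any
    nonzero [c] in [I]; then [x ^+ 2 - c ^+ 2] lies in [I], so
    [x + c] or [x - c] does, and either way [x] does ([sdf_absorbing_sqr]).

    Apply this to the principal ideal of [x ^+ 2].  It is zero, or the whole
    ring, or a nonzero proper ideal and hence radical; so every [x] satisfies
    [x ^+ 2 = 0] or [x ^+ 2 * y = x] for some [y] ([sqr_eq0_or_regular]).
    Modulo nilpotents both cases are regularity of [x].

    If R / nil(R) is von Neumann regular, then [x * (1 - x * y)] is nilpotent
    for some [y], so a prime that omits [x] contains [1 - x * y] and no proper
    ideal containing that prime can contain [x]: primes form an antichain.
    Dimension 0 (as opposed to an empty spectrum) also requires some prime to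
    exist; it is obtained from Zorn's lemma ([prime_ideal_exists]).

    Finally, a nilpotent [x] with [x ^+ 2 * y = x] vanishes, so all nilpotents
    square to 0 and lie in every nonzero ideal, by radicality.  When nil(R) is
    itself nonzero this makes it the least nonzero ideal. *)

Import GRing.Theory.

Local Open Scope ring_scope.
Local Open Scope quotient_scope.

Set Implicit Arguments.
Unset Strict Implicit.
Unset Printing Implicit Defensive.

(** * Prime ideals *)

(** The usual argument that an ideal maximal among the proper ones is prime.
    Zorn's lemma is applied to the sets closed under [a * u + v] that avoid 1,
    without asking for 0: this admits the empty set, which is the union of the
    empty chain.  A maximal such set still contains 0, since otherwise it
    would be empty and smaller than the zero ideal. *)
Lemma prime_ideal_exists (R : comNzRingType) :
  exists P : {pred R}, is_prime_ideal P.
Proof.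
pose proper (A : set R) :=
  ~ A 1 /\ forall a u v, A u -> A v -> A (a * u + v).
have [F Fproper Ftot|A [[A1 Acl] Amax]] := @Zorn_bigcup R proper.
  split=> [[X FX X1]|a u v [X FX Xu] [Y FY Yv]]; first by case: (Fproper X FX).
  by have [XY|YX] := Ftot X Y FX FY;
    [exists Y => //; apply: (Fproper Y FY).2 => //; apply: XY
    |exists X => //; apply: (Fproper X FX).2 => //; apply: YX].
have A0 : A 0.
  apply: contrapT => nA0; apply: (Amax (fun z => z = 0)).
    split=> [u Au|sub0]; last exact/nA0/sub0.
    by case: nA0; rewrite -(addNr u) -mulN1r; apply: Acl.
  split=> [/eqP|a u v -> ->]; first by rewrite oner_eq0.
  by rewrite mulr0 addr0.
exists (fun x => `[< A x >]); split.
  split; first exact/asboolP.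
    exact/asboolP.
  by move=> a u v /asboolP Au /asboolP Av; apply/asboolP/Acl.
move=> u v /asboolP Auv; apply/orP.
have [Au|nAu] := pselect (A u); first by left; apply/asboolP.
right; apply/asboolP.
(* Otherwise [A + R u] is larger than [A], hence contains 1. *)
pose B : set R := fun z => exists a r, A a /\ z = a + r * u.
have [a [r [Aa def1]]] : B 1.
  apply: contrapT => nB1; case: (Amax B).
    split=> [z Az|BA]; first by exists z, 0; rewrite mul0r addr0.
    by apply/nAu/BA; exists 0, 1; rewrite mul1r add0r.
  split=> // c _ _ [a1 [r1 [Aa1 ->]]] [a2 [r2 [Aa2 ->]]].
  exists (c * a1 + a2), (c * r1 + r2); split; first exact: Acl.
  by rewrite mulrDr mulrDl mulrA addrACA.
have -> : v = v * a + r * (u * v).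
  by rewrite -[LHS]mulr1 def1 mulrDr mulrCA [v * u]mulrC.
have mulA c z : A z -> A (c * z) by move=> Az; rewrite -[_ * _]addr0; exact: Acl.
by apply: Acl => //; apply: mulA.
Qed.

Lemma nilradical_sub_prime (R : comNzRingType) (P : {pred R}) :
  is_prime_ideal P -> {subset nilradical R <= P}.
Proof.
move=> [[P0 P1 _] Pprime] x /asboolP[n]; elim: n => [|n IHn].
  by rewrite expr0 => /eqP; rewrite oner_eq0.
move=> xn0; have : x * x ^+ n \in P by rewrite -exprS xn0.
case/Pprime/orP => // {xn0 IHn}; elim: n => [|n IHn].
  by rewrite expr0 (negPf P1).
by rewrite exprS => /Pprime/orP[].
Qed.

(** * Regularity of the quotient by the nilradical *)

(** Regularity of the quotient expressed by elements of [R], so that primes of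
    [R] can be reasoned about without lifting them to the quotient. *)
Lemma quot_nilradical_regularP (R : comNzRingType) :
  von_neumann_regular {ideal_quot (nilradical R : idealr R)} <->
  forall x : R, exists y, x ^+ 2 * y - x \in nilradical R.
Proof.
split=> reg x.
  have [y] := reg (\pi x); rewrite -[y]reprK expr2 => def_x.
  exists (repr y); rewrite (Quotient.idealrBE (nilradical R : idealr R)).
  by apply/eqP; rewrite expr2 !rmorphM.
have [y nil_xy] := reg (repr x); exists (\pi y).
move: nil_xy.
rewrite (Quotient.idealrBE (nilradical R : idealr R)) => /eqP.
by rewrite !expr2 !rmorphM /= reprK.
Qed.

(** Along [P 0 < P 1] with [x] in the difference, regularity puts
    [x * (x * y - 1)] in [P 0], hence [x * y - 1] too; then [P 1] contains both
    [x] and [x * y - 1], and so 1. *)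
Lemma krull_dim_eq0 (R : comNzRingType) :
  von_neumann_regular {ideal_quot (nilradical R : idealr R)} ->
  krull_dim_is R 0.
Proof.
move=> /quot_nilradical_regularP reg; split.
  by have [P primeP] := prime_ideal_exists R; exists (fun=> P); split.
case=> // m P [primeP /(_ 0%N (ltn0Sn m))[P01 [x P1x nP0x]]].
have primeP0 := primeP 0%N (leq0n _).
have [[P1_0 nP1_1 P1cl] _] := primeP 1%N (ltn0Sn m).
have [y /(nilradical_sub_prime primeP0)] := reg x.
have -> : x ^+ 2 * y - x = x * (x * y - 1) by rewrite mulrBr mulr1 mulrA expr2.
case/primeP0.2/orP => [|/P01 P1xy]; first by rewrite (negPf nP0x).
case/negP: nP1_1; have -> : 1 = y * x + (-1 * (x * y - 1) + 0).
  by rewrite addr0 mulN1r opprB mulrC addrC subrK.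
by apply: (P1cl) => //; apply: (P1cl).
Qed.

(** * Rings whose nonzero proper ideals are sdf-absorbing *)

(** Nonzero ideals are needed because the absorbing condition only concerns
    pairs of nonzero elements: the second one must be taken inside [I], where
    neither its square nor its sign affects membership. *)
Lemma sdf_absorbing_sqr (R : comNzRingType) (I : {pred R}) x :
  sdf_absorbing I -> nonzero_ideal I -> x ^+ 2 \in I -> x \in I.
Proof.
move=> [[I0 _ Icl] Isdf] [c Ic c0] Ix2.
have [->|x0] := eqVneq x 0; first by [].
have Ix2c2 : x ^+ 2 - c ^+ 2 \in I.
  by rewrite addrC expr2 -mulNr; apply: Icl.
case: (Isdf x c x0 c0 Ix2c2) => Ixc.
  by have -> : x = -1 * c + (x + c); [rewrite mulN1r addrC addrK | apply: Icl].
by have -> : x = 1 * c + (x - c); [rewrite mul1r addrC subrK | apply: Icl].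
Qed.

Section SdfRing.

Variable R : comNzRingType.
Hypothesis sdfR : forall I : {pred R},
  idealr_closed I -> nonzero_ideal I -> sdf_absorbing I.

(** The principal ideal of [x ^+ 2] is zero (left alternative), the whole ring
    ([x] is then a unit), or radical. *)
Lemma sqr_eq0_or_regular (x : R) : x ^+ 2 = 0 \/ exists y, x ^+ 2 * y = x.
Proof.
have [->|x2n0] := eqVneq (x ^+ 2) 0; [by left | right].
pose I : {pred R} := fun z => `[< exists r, z = x ^+ 2 * r >].
have Ix2 : x ^+ 2 \in I by apply/asboolP; exists 1; rewrite mulr1.
have [/asboolP[r def1]|I1] := boolP (1 \in I).
  by exists (r * x); rewrite mulrA -def1 mul1r.
have Inz : nonzero_ideal I by exists (x ^+ 2).
have idI : idealr_closed I.
  split=> // [|a u v /asboolP[r ->] /asboolP[s ->]].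
    by apply/asboolP; exists 0; rewrite mulr0.
  by apply/asboolP; exists (a * r + s); rewrite mulrDr mulrCA.
have /asboolP[y def_x] := sdf_absorbing_sqr (sdfR idI Inz) Inz Ix2.
by exists y.
Qed.

(** The regular alternative for [x] can be iterated, which no nonzero nilpotent
    element survives. *)
Lemma nilpotent_sqr (x : R) : x \in nilradical R -> x ^+ 2 = 0.
Proof.
move=> /asboolP[n xn0]; have [//|[y xy]] := sqr_eq0_or_regular x.
(* Iterating [x = x * (x * y)] exhibits [x] as a multiple of [x ^+ n]. *)
have def_x : x = x * (x * y) ^+ n.
  elim: n {xn0} => [|n IHn]; first by rewrite expr0 mulr1.
  by rewrite exprS !mulrA -expr2 xy.
by rewrite exprMn xn0 mul0r mulr0 in def_x; rewrite def_x expr0n.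
Qed.

(** Proper nonzero ideals contain every element whose square is 0.  Allowing
    the whole ring here spares proving that a minimal nonzero ideal is
    proper. *)
Lemma nilradical_sub_nonzero_ideal (I : {pred R}) :
  ideal_closed I -> nonzero_ideal I -> {subset nilradical R <= I}.
Proof.
move=> idI Inz x nil_x; have [I0 Icl] := idI.
have [I1|nI1] := boolP (1 \in I); first by rewrite -[x]mulr1 -[_ * _]addr0 Icl.
apply: (sdf_absorbing_sqr _ Inz); last by rewrite nilpotent_sqr.
by apply: sdfR => //; apply/idealr_closedE.
Qed.

End SdfRing.

Theorem theorem3p1 (R : comNzRingType)
  (sdfR : forall I : {pred R},
     idealr_closed I -> nonzero_ideal I -> sdf_absorbing I) :
  von_neumann_regular {ideal_quot (nilradical R : idealr R)} /\
  krull_dim_is R 0 /\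
  (~ reduced R ->
     minimal_nonzero_ideal (nilradical R) /\
     forall I : {pred R}, minimal_nonzero_ideal I -> I =i nilradical R).
Proof.
have regR : von_neumann_regular {ideal_quot (nilradical R : idealr R)}.
  apply/quot_nilradical_regularP => x.
  have [x20|[y xy]] := sqr_eq0_or_regular sdfR x; last first.
    by exists y; rewrite xy subrr rpred0.
  by exists 0; rewrite mulr0 sub0r rpredN; apply/asboolP; exists 2.
split=> //; split=> [|nred]; first exact: krull_dim_eq0.
have nil_closed : ideal_closed (nilradical R).
  by have /idealr_closedE[] := nilradical_idealr_closed R.
have nil_nz : nonzero_ideal (nilradical R).
  apply: contrapT => nil0; apply: nred => x; rewrite inE.
  apply/idP/eqP => [nil_x|->]; last exact: nil_closed.1.
  by apply/eqP; apply: contrapT => /negP x0; apply: nil0; exists x.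
split=> [|I [idI Inz Imin]].
  split=> // J idJ Jnz Jnil x; apply/idP/idP; first exact: Jnil.
  exact: nilradical_sub_nonzero_ideal.
have nilI := nilradical_sub_nonzero_ideal sdfR idI Inz.
by move=> x; rewrite (Imin _ nil_closed nil_nz nilI).
Qed.
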